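(* Assume that there exists a topologically free continuous orbit couple for groups $G$ and $H$. If $G$ is finitely generated, then so is $H$, and $G$ and $H$ are quasi-isometric. In particular, if topologically free systems $G \curvearrowright X$ and $H \curvearrowright Y$ on compact spaces $X$ and $Y$ are continuously orbit equivalent, and if $G$ is finitely generated, then so is $H$, and $G$ and $H$ are quasi-isometric.
   Context: All groups are discrete and countable; all topological spaces are locally compact and Hausdorff. A (topological dynamical) system $G \curvearrowright X$ is an action $(g,x) \mapsto g.x$ by homeomorphisms; it is topologically free if for every $e \neq g \in G$ the set $\{x \in X : g.x \neq x\}$ is dense in $X$. A continuous orbit couple for $G$ and $H$ consists of topological dynamical systems $G \curvearrowright X$, $H \curvearrowright Y$ on compact spaces $X$, $Y$ and continuous maps $p: X \to Y$, $q: Y \to X$ for which there exist continuous maps $a: G \times X \to H$, $b: H \times Y \to G$, $g: X \to G$, $h: Y \to H$ (with $G$, $H$ discrete) such that $p(s.x) = a(s,x).p(x)$, $q(t.y) = b(t,y).q(y)$, $qp(x) = g(x).x$ and $pq(y) = h(y).y$ for all $s \in G$, $t \in H$, $x \in X$, $y \in Y$. It is topologically free if $G \curvearrowright X$ and $H \curvearrowright Y$ are topologically free. $G \curvearrowright X$ and $H \curvearrowright Y$ are continuously orbit equivalent if there exist a homeomorphism $\varphi: X \to Y$ with inverse $\psi$ and continuous maps $a: G \times X \to H$, $b: H \times Y \to G$ such that $\varphi(g.x) = a(g,x).\varphi(x)$ and $\psi(h.y) = b(h,y).\psi(y)$ for all $g,x,h,y$. Finitely generated groups are regarded as metric spaces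 via word metrics. *)

(* Defs.v *)
From HB Require Import structures.
From mathcomp Require Import all_boot all_order all_algebra.
From mathcomp Require Import all_classical all_reals all_analysis.

Set Implicit Arguments.
Unset Strict Implicit.
Unset Printing Implicit Defensive.

Import Order.TTheory GRing.Theory Num.Theory.

Local Open Scope classical_set_scope.
Local Open Scope group_scope.

(* Each [act g] is a homeomorphism, with continuous inverse [act g^-1]. *)
Record system (G : groupType) (X : topologicalType) := System {
  act :> G -> X -> X;
  act1 : forall x, act 1 x = x;
  actM : forall g h x, act (g * h) x = act g (act h x);
  act_continuous : forall g, continuous (act g) }.

Definition topologically_free (G : groupType) (X : topologicalType)
    (sX : system G X) : Prop :=
  forall g : G, g <> 1 -> dense [set x | sX g x <> x].

(* Spaces are locally compact Hausdorff; for the compact spaces below, local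
   compactness is automatic. The underlying space is required to be nonempty:
   actions on the empty space are topologically free, and would form a
   continuous orbit couple for any two groups. *)
Record continuous_orbit_couple (G H : groupType) := ContinuousOrbitCouple {
  coc_X : topologicalType;
  coc_Y : topologicalType;
  coc_X_hausdorff : hausdorff_space coc_X;
  coc_Y_hausdorff : hausdorff_space coc_Y;
  coc_X_compact : compact [set: coc_X];
  coc_Y_compact : compact [set: coc_Y];
  coc_X_nonempty : [set: coc_X] !=set0;
  coc_actX : system G coc_X;
  coc_actY : system H coc_Y;
  coc_p : coc_X -> coc_Y;
  coc_q : coc_Y -> coc_X;
  coc_p_continuous : continuous coc_p;
  coc_q_continuous : continuous coc_q;
  coc_cocycles :
    exists (a : discrete_topology G * coc_X -> discrete_topology H)
           (b : discrete_topology H * coc_Y -> discrete_topology G)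
           (g : coc_X -> discrete_topology G)
           (h : coc_Y -> discrete_topology H),
      [/\ continuous a, continuous b, continuous g & continuous h] /\
      [/\ forall s x, coc_p (coc_actX s x) = coc_actY (a (s, x)) (coc_p x),
          forall t y, coc_q (coc_actY t y) = coc_actX (b (t, y)) (coc_q y),
          forall x, coc_q (coc_p x) = coc_actX (g x) x
        & forall y, coc_p (coc_q y) = coc_actY (h y) y] }.

Definition topologically_free_couple (G H : groupType)
    (c : continuous_orbit_couple G H) : Prop :=
  topologically_free (coc_actX c) /\ topologically_free (coc_actY c).

Definition continuously_orbit_equivalent (G H : groupType)
    (X Y : topologicalType) (sX : system G X) (sY : system H Y) : Prop :=
  exists (phi : X -> Y) (psi : Y -> X),
    [/\ continuous phi, continuous psi, cancel phi psi & cancel psi phi] /\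
    exists (a : discrete_topology G * X -> discrete_topology H)
           (b : discrete_topology H * Y -> discrete_topology G),
      [/\ continuous a, continuous b,
          forall g x, phi (sX g x) = sY (a (g, x)) (phi x)
        & forall h y, psi (sY h y) = sX (b (h, y)) (psi y)].

Definition generates (G : groupType) (S : seq G) : Prop :=
  forall A : {pred G}, group_closed A -> {subset S <= A} -> forall g, g \in A.

Definition finitely_generated (G : groupType) : Prop :=
  exists S : seq G, generates S.

Definition has_word (G : groupType) (S : seq G) (g : G) (n : nat) : Prop :=
  exists w : seq G,
    [/\ size w = n, all (fun s => (s \in S) || (s^-1 \in S)) w
      & \prod_(s <- w) s = g].

(* The default value 0 is only reached when [S] does not generate [G]. *)
Definition word_length (G : groupType) (S : seq G) (g : G) : nat :=
  if pselect (exists n, `[< has_word S g n >]) is left e then ex_minn e else 0%N.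

Definition word_dist (R : realType) (G : groupType) (S : seq G) (g h : G) : R :=
  ((word_length S (g^-1 * h))%:R)%R.

Definition quasi_isometry (R : realType) (T U : Type)
    (dT : T -> T -> R) (dU : U -> U -> R) (f : T -> U) : Prop :=
  exists K C : R,
    [/\ (1 <= K)%R, (0 <= C)%R,
        forall x y, (K^-1 * dT x y - C <= dU (f x) (f y) <= K * dT x y + C)%R
      & forall u, exists x, (dU (f x) u <= C)%R].

(* To be read for finitely generated [G] and [H]: the word metrics of any two
   finite generating sets are quasi-isometric. *)
Definition quasi_isometric_groups (R : realType) (G H : groupType) : Prop :=
  forall (S : seq G) (T : seq H), generates S -> generates T ->
    exists f : G -> H, quasi_isometry (word_dist R S) (word_dist R T) f.

(* Main.v *)
(* Since [q \o p] and [p \o q] are locally translations by group elements, [p]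
   is open; so by Baire some [x] has trivial stabilizer together with [p x].
   Along the orbits of such an [x] the cocycles are genuine functions
   [f s = a (s, x)] and [e t = b (t, p x) * g x]. By compactness [a (s, -)],
   [b (t, -)], [g] and [h] take finitely many values, so [f] and [e] are
   Lipschitz for the right-invariant word metrics, and the identities
   [e (f s) = g (s.x) * s] and [f (e t) = h (t.(p x)) * t] make them mutually
   inverse up to bounded error. *)
Require Import Defs.
From mathcomp Require Import all_boot all_order all_algebra.
From mathcomp Require Import all_classical all_reals all_analysis.

Import Order.TTheory GRing.Theory Num.Theory.

Local Open Scope classical_set_scope.
Local Open Scope group_scope.

Set Implicit Arguments.
Unset Strict Implicit.

(** * Word length over a finite generating set *)

Section WordLength.
Variables (G : groupType) (S : seq G).

Lemma has_word1 : has_word S 1 0.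
Proof. by exists [::]; rewrite big_nil. Qed.

Lemma has_wordM g h m n :
  has_word S g m -> has_word S h n -> has_word S (g * h) (m + n).
Proof.
move=> [v [<- Sv <-]] [w [<- Sw <-]]; exists (v ++ w).
by rewrite size_cat all_cat Sv Sw big_cat.
Qed.

Lemma has_wordV g n : has_word S g n -> has_word S g^-1 n.
Proof.
move=> [w [<- Sw <-]]; exists (rev [seq s^-1 | s <- w]); split.
- by rewrite size_rev size_map.
- rewrite all_rev all_map; apply: sub_all Sw => s /=.
  by rewrite invgK orbC.
- by rewrite -map_rev big_map prodgV revK.
Qed.

Hypothesis genS : generates S.

(** The products of letters form a subgroup containing [S], so generation applies to them. *)
Lemma generates_has_word g : exists n, has_word S g n.
Proof.
pose A := [pred g | `[< exists n, has_word S g n >]].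
suff: g \in A by move/asboolP.
apply: genS => [|s Ss].
  split; first by apply/asboolP; exists 0%N; exact: has_word1.
  move=> u v /asboolP[m um] /asboolP[n vn]; apply/asboolP.
  by exists (m + n)%N; exact/has_wordM/has_wordV.
by apply/asboolP; exists 1%N, [:: s]; rewrite /= Ss big_seq1.
Qed.

Lemma word_lengthP g : has_word S g (word_length S g).
Proof.
rewrite /word_length; case: pselect => [e|[]].
  by case: ex_minnP => n /asboolP.
by have [n gn] := generates_has_word g; exists n; exact/asboolP.
Qed.

Lemma word_length_le g n : has_word S g n -> (word_length S g <= n)%N.
Proof.
move=> gn; rewrite /word_length; case: pselect => // e.
by case: ex_minnP => m _; apply; exact/asboolP.
Qed.

Lemma word_lengthM g h :
  (word_length S (g * h)%g <= word_length S g + word_length S h)%N.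
Proof. exact/word_length_le/has_wordM/word_lengthP/word_lengthP. Qed.

Lemma word_lengthV g : word_length S g^-1 = word_length S g.
Proof.
apply/eqP; rewrite eqn_leq; apply/andP; split.
  exact/word_length_le/has_wordV/word_lengthP.
by rewrite -{1}[g]invgK; exact/word_length_le/has_wordV/word_lengthP.
Qed.

Lemma word_length_bounded (F : seq G) :
  exists M, forall g, g \in F -> (word_length S g <= M)%N.
Proof.
by exists (\max_(g <- F) word_length S g)%N => g Fg; exact: leq_bigmax_seq.
Qed.

End WordLength.

(** * Coarse maps between groups *)

(* Lipschitz for the right-invariant word metrics. *)
Definition coarse_map (G H : groupType) (f : G -> H) : Prop :=
  forall s, exists F : seq H, forall t, f (s * t) / f t \in F.

(** Bounded distance to the identity in a right-invariant word metric; the finite set [F] avoids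
    choosing generators. *)
Definition close_to_id (G : groupType) (f : G -> G) : Prop :=
  exists F : seq G, forall t, f t / t \in F.

Definition letters (G : groupType) (S : seq G) : seq G := S ++ [seq s^-1 | s <- S].

Lemma word_letters (G : groupType) (S w : seq G) :
  all (fun s => (s \in S) || (s^-1 \in S)) w -> {subset w <= letters S}.
Proof.
move=> /allP Sw s /Sw /orP[Ss|Ss]; rewrite mem_cat ?Ss//.
by rewrite -[s]invgK (map_f (fun s => s^-1)) ?orbT.
Qed.

(** Peeling one letter [s] off a word for [w] costs at most a bound [M s] uniform in the base point.
    There are finitely many letters, so the maximum of these bounds serves as [L]. *)
Lemma coarse_map_lipschitz (G H : groupType) (S : seq G) (T : seq H) (f : G -> H) :
  generates S -> generates T -> coarse_map f ->
  exists L, forall w u,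
    (word_length T (f (w * u) / f u)%g <= L * word_length S w)%N.
Proof.
move=> genS genT cf.
have bnd s : exists M, forall t, (word_length T (f (s * t) / f t)%g <= M)%N.
  have [F Ff] := cf s; have [M FM] := word_length_bounded T F.
  by exists M => t; exact/FM/Ff.
have [M fM] := choice bnd.
exists (\max_(s <- letters S) M s)%N => w u.
have [v [<- /word_letters Sv <-]] := word_lengthP genS w.
elim: v Sv => [|s v IHv] Sv.
  rewrite big_nil mul1g mulgV; apply: (@leq_trans 0%N) => //.
  exact/word_length_le/has_word1.
rewrite big_cons -mulgA -(divgKA (f (\prod_(t <- v) t * u))).
apply: leq_trans (word_lengthM genT _ _) _; rewrite /= mulnS leq_add//.
  apply: leq_trans (fM s _) _; apply: leq_bigmax_seq => //.
  by apply: Sv; rewrite mem_head.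
by apply: IHv => t vt; apply: Sv; rewrite inE vt orbT.
Qed.

Section CoarseMaps.
Variables (G H : groupType) (f : G -> H) (e : H -> G).
Hypotheses (cf : coarse_map f) (fe1 : close_to_id (f \o e)).

Lemma coarse_map_finitely_generated :
  finitely_generated G -> finitely_generated H.
Proof.
move=> [S genS]; have [K fK] := fe1; have [F fF] := choice cf.
(* The value [f 1] and the increments along letters generate the image of [f]; the errors in [K]
   lead from [f (e t)] to [t]. *)
exists (f 1 :: K ++ flatten (map F (letters S))) => A gA TA t.
have AM := group_closedM gA; have AV := group_closedV gA.
suff fA g : f g \in A.
  rewrite -[t]invgK; apply: (AV); rewrite -[_^-1](mulKg (f (e t))).
  apply: (AM); first exact/AV/fA.
  by apply: TA; rewrite inE mem_cat fK orbT.
have [n [v [_ /word_letters Sv <-]]] := generates_has_word genS g.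
elim: v Sv => [|s v IHv] Sv; first by rewrite big_nil; apply: TA; rewrite mem_head.
rewrite big_cons -[f _](mulgVK (f (\prod_(t <- v) t))).
apply: (AM); last by apply: IHv => u vu; apply: Sv; rewrite inE vu orbT.
apply: TA; rewrite inE mem_cat; apply/orP; right; apply/orP; right.
by apply/flatten_mapP; exists s => //; apply: Sv; rewrite mem_head.
Qed.

Hypotheses (ce : coarse_map e) (ef1 : close_to_id (e \o f)).

(* Word metrics are left-invariant, whence the conjugation of [f] by inversion. *)
Lemma coarse_map_quasi_isometry (R : realType) (S : seq G) (T : seq H) :
  generates S -> generates T ->
  quasi_isometry (word_dist R S) (word_dist R T) (fun s => (f s^-1)^-1).
Proof.
move=> genS genT.
have [L fL] := coarse_map_lipschitz genS genT cf.
have [L' eL'] := coarse_map_lipschitz genT genS ce.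
have [[F fF] [F' eF']] := (fe1, ef1).
have [M FM] := word_length_bounded T F; have [M' FM'] := word_length_bounded S F'.
have fM t : (word_length T (f (e t) / t)%g <= M)%N by exact/FM/fF.
have eM' t : (word_length S (e (f t) / t)%g <= M')%N by exact/FM'/eF'.
(* The successor gives [1 <= K]. In [C], the lower bound uses [M'] twice, once at each endpoint, and
   coarse surjectivity uses [M]. *)
pose K := (L + L').+1; pose C := (M + 2 * M')%N.
have upper x y : (word_length T ((f x^-1)^-1^-1 * (f y^-1)^-1)%g
    <= K * word_length S (x^-1 * y)%g)%N.
  rewrite invgK; have := fL (x^-1 * y)%g y^-1; rewrite mulgK => /leq_trans; apply.
  by rewrite leq_mul2r /K leqW ?orbT// leq_addr.
have lower x y : (word_length S (x^-1 * y)%g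
    <= K * word_length T ((f x^-1)^-1^-1 * (f y^-1)^-1)%g + C)%N.
  rewrite invgK; set u := x^-1; set v := y^-1.
  rewrite -[y]invgK -/v.
  (* The outer factors have length at most [M']; the middle one is controlled by the Lipschitz bound
     for [e]. *)
  have -> : u / v = (e (f u) / u)^-1 * (e (f u) / e (f v)) * (e (f v) / v).
    by rewrite invgF !mulgA !mulgVK.
  apply: leq_trans (word_lengthM genS _ _) _.
  rewrite (_ : C = M' + (M + M'))%N; last by rewrite /C mul2n -addnn addnCA.
  rewrite addnA; apply: leq_add; last exact: leq_trans (eM' v) (leq_addl _ _).
  apply: leq_trans (word_lengthM genS _ _) _.
  rewrite word_lengthV// addnC leq_add//.
  have := eL' (f u / f v) (f v); rewrite mulgVK => /leq_trans; apply.
  by rewrite leq_mul2r /K leqW ?orbT// leq_addl.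
exists K%:R%R, C%:R%R; split; rewrite ?ler1n ?ler0n//.
- move=> x y; rewrite /word_dist -natrM -natrD ler_nat; apply/andP; split.
    rewrite lerBlDr ler_pdivrMl ?ltr0n// -natrD -natrM ler_nat.
    (* Clearing [K^-1] turns the additive constant into [K * C], which is at least [C]. *)
    by apply: leq_trans (lower x y) _; rewrite mulnDr leq_add// leq_pmull.
  exact: leq_trans (upper x y) (leq_addr _ _).
- move=> u; exists (e u^-1)^-1; rewrite /word_dist ler_nat !invgK.
  rewrite -[u in _ * u]invgK.
  exact: leq_trans (fM u^-1) (leq_addr _ _).
Qed.

End CoarseMaps.

(** * Compactness: finite images and Baire category *)

Lemma compact_discrete_finite (T : discreteTopologicalType) (A : set T) :
  compact A -> finite_set A.
Proof.
move=> cA; apply: contrapT => infA.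
(* For infinite [A] this cofinite filter is proper, yet no [p] is a cluster point: the complement of
   [p] belongs to it and misses the neighbourhood [[set p]]. *)
pose F : set_system T := [set B | finite_set (A `\` B)].
have FF : ProperFilter F.
  split; first by rewrite /F /= setD0.
  split; first by rewrite /F /= setDT.
  - by move=> P Q; rewrite /F /= setDIr finite_setU.
  - by move=> P Q PQ; apply: sub_finite_set; exact: setDS.
have [|p [Ap /(_ (~` [set p]) [set p])]] := cA F FF.
  by rewrite /F /= setDv.
case.
- by rewrite /F /= setDE setCK; apply: sub_finite_set (finite_set1 p) => ? [].
- exact: discrete_set1.
- by move=> ? [].
Qed.

Lemma compact_image_discrete (X : topologicalType) (T : choiceType)
    (f : X -> discrete_topology T) :
  compact [set: X] -> continuous f -> exists F : seq T, forall x, f x \in F.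
Proof.
move=> cX cf; have /finite_seqP[F fF] : finite_set (f @` [set: X]).
  by apply/compact_discrete_finite/continuous_compact => //; exact: continuous_subspaceT.
by exists F => x; have : (f @` [set: X]) (f x) by []; rewrite fF.
Qed.

Lemma nbhs_discrete_eq (X : topologicalType) (T : choiceType)
    (f : X -> discrete_topology T) x :
  continuous f -> nbhs x [set y | f y = f x].
Proof. by move=> cf; exact: (cf x _ (discrete_set1 _)). Qed.

(** Nested nonempty open sets are chosen, each with closure inside its predecessor, entering the
    members of [U] one by one; compactness provides a common point. *)
Lemma compact_hausdorff_baire (X : topologicalType) (U : set (set X)) :
  hausdorff_space X -> compact [set: X] -> countable U ->
  (forall A, U A -> open A /\ dense A) -> dense (\bigcap_(A in U) A).
Proof.
move=> hX cX cU odU O O0 oO.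
have [e einj] : exists e : set X -> nat, set_inj U e by exact/countable_injP.
pose good (W : set X) := open W /\ W !=set0.
(* Goodness is a premise under the existential, so that choice yields a total function to
   iterate. *)
have step (nW : nat * set X) : exists W', good nW.2 ->
    [/\ good W', closure W' `<=` nW.2
      & forall A, U A -> e A = nW.1 -> W' `<=` A].
  case: nW => n W /=; have [[oW W0]|nW] := pselect (good W); last by exists set0 => /nW.
  (* At most one member of [U] has code [n]; if there is none, [W] itself serves. *)
  have [B [oB [x Bx] BW BU]] : exists B, [/\ open B, B !=set0, B `<=` W
      & forall A, U A -> e A = n -> B `<=` A].
    have [[A [UA eA]]|noA] := pselect (exists A, U A /\ e A = n); last first.
      by exists W; split=> // A UA eA; case: noA; exists A.
    have [oA dA] := odU A UA; exists (W `&` A); split.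
    - exact: openI.
    - exact: dA.
    - by move=> ? [].
    - move=> A' UA' eA'; rewrite (einj A' A) ?inE ?eA ?eA'//.
  have [C xC CB] : filter_from (nbhs x) closure B.
    by apply: (compact_regular hX cX); [exact: filterT|exact: open_nbhs_nbhs].
  exists (interior C) => _; split.
  - by split; [exact: open_interior|exists x].
  - by move=> y /(closure_subset (@interior_subset _ C))/CB/BW.
  - move=> A UA eA y /interior_subset/subset_closure/CB; exact: BU.
have {step} [next nextP] := choice step.
pose W := fix W n := if n is m.+1 then next (m, W m) else O.
have goodW n : good (W n) by elim: n => [|n IHn] //=; have [] := nextP (n, W n) IHn.
have decW m n : (m <= n)%N -> W n `<=` W m.
  move=> /subnK <-; elim: (n - m)%N => [//|k IHk] y.
  have [_ clW _] := nextP ((k + m)%N, W (k + m)%N) (goodW (k + m)%N).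
  by move=> /subset_closure/clW/IHk.
pose F : set_system X := filter_from [set: nat] W.
have FF : ProperFilter F.
  apply: filter_from_proper; last by move=> n _; exact: (goodW n).2.
  apply: filter_fromT_filter; first by exists 0%N.
  by move=> i j; exists (maxn i j) => y Wy; split; apply: decW Wy;
    rewrite ?leq_maxl ?leq_maxr.
have [x [_ clx]] := cX F FF filterT.
(* A cluster point lies in the closure of [W n.+1], which is contained in [W n]. *)
have Wx n : W n x.
  have [_ clW _] := nextP (n, W n) (goodW n); apply: clW => B xB.
  by apply: clx xB; exists n.+1.
exists x; split; first exact: (Wx 0%N).
move=> A UA; have [_ _ /(_ A UA erefl)] := nextP (e A, W (e A)) (goodW _).
(* Stage [e A] handles [A], so the next set is the first one known to lie in [A]. *)
by apply; exact: (Wx (e A).+1).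
Qed.

(** * Points with trivial stabilizer *)

Section Systems.
Variables (G : groupType) (X : topologicalType) (sX : system G X).

Lemma actK g : cancel (sX g) (sX g^-1).
Proof. by move=> x; rewrite -actM mulVg act1. Qed.

Lemma actVK g : cancel (sX g^-1) (sX g).
Proof. by move=> x; rewrite -actM mulgV act1. Qed.

Lemma act_inj g : injective (sX g).
Proof. exact: can_inj (actK g). Qed.

Definition free_point (x : X) : Prop := forall g, sX g x = x -> g = 1.

(** Turns equalities of points on a free orbit into equalities in the group; the cocycle identities
    below are obtained this way. *)
Lemma free_point_inj x g h : free_point x -> sX g x = sX h x -> g = h.
Proof.
move=> fx gh; have /mulg1_eq <- : h^-1 * g = 1; last by rewrite invgK.
by apply: fx; rewrite actM gh actK.
Qed.

Lemma free_point_act x g : free_point x -> free_point (sX g x).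
Proof.
move=> fx h; rewrite -actM => /(free_point_inj fx) hg.
by apply: (mulIg g); rewrite mul1g.
Qed.

Lemma moved_open g : hausdorff_space X -> open [set x | sX g x <> x].
Proof.
rewrite open_hausdorff => hX; rewrite openE => x /= /eqP gx.
have [[A B] /= [] /[!inE] Ax Bx [oA oB AB0]] := hX _ _ gx.
have : nbhs x (sX g @^-1` A `&` B).
  apply: filterI; last exact: open_nbhs_nbhs.
  by apply: act_continuous; exact: open_nbhs_nbhs.
apply: filterS => y [Agy By] gy.
suff : (A `&` B) y by rewrite AB0.
by split=> //; rewrite -gy.
Qed.

End Systems.

(** * Orbit couples and their cocycles *)

Section OrbitCouple.
Variables (G H : groupType) (X Y : topologicalType).
Variables (sX : system G X) (sY : system H Y) (p : X -> Y) (q : Y -> X).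
Variables (g : X -> discrete_topology G) (h : Y -> discrete_topology H).
Hypotheses (pc : continuous p) (qc : continuous q).
Hypotheses (gc : continuous g) (hc : continuous h).
Hypothesis qp : forall x, q (p x) = sX (g x) x.
Hypothesis pq : forall y, p (q y) = sY (h y) y.

(* Locally [q \o p] and [p \o q] act as group elements, hence are local
   homeomorphisms. *)
Lemma couple_open_map (U : set X) : open U -> open (p @` U).
Proof.
move=> oU; rewrite openE => _ [x Ux <-].
pose V := [set y | h y = h (p x)].
have nV : nbhs (p x) V by exact: nbhs_discrete_eq.
(* On [N] both [g] and [h \o p] are constant, so a preimage of [y] near [p x] must be
   [(g x)^-1.(q y)]. *)
pose N := U `&` [set z | g z = g x] `&` p @^-1` V.
have nN : nbhs x N.
  apply: filterI; last exact: pc.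
  by apply: filterI; [exact: open_nbhs_nbhs|exact: nbhs_discrete_eq].
have : nbhs (p x) (V `&` (sX (g x)^-1 \o q) @^-1` N).
  apply: filterI => //; apply: continuous_comp; [exact: qc|exact: act_continuous|].
  by rewrite /= qp actK.
apply: filterS => y [Vy [[Uz gz] Vz]]; exists (sX (g x)^-1 (q y)) => //.
apply: (@act_inj _ _ sY (h (p x))).
by rewrite -{1}Vz -pq qp gz actVK pq Vy.
Qed.

Lemma couple_free_point : countable [set: G] -> countable [set: H] ->
  hausdorff_space X -> hausdorff_space Y -> compact [set: X] ->
  [set: X] !=set0 -> topologically_free sX -> topologically_free sY ->
  exists x, free_point sX x /\ free_point sY (p x).
Proof.
move=> cG cH hX hY cX X0 fX fY.
pose UX s := [set x | sX s x <> x].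
pose UY t := p @^-1` [set y | sY t y <> y].
(* A point in every member of [U] is moved by each nontrivial element of [G], and its image under
   [p] by each one of [H]. *)
pose U := (UX @` [set~ 1]) `|` (UY @` [set~ 1]).
have cU : countable U.
  rewrite /U -bigcup2E; apply: bigcup_countable => [|[|[|n]] _]; rewrite /bigcup2 /=.
  - exact: countableP.
  - exact/(sub_countable (card_image_le _ _))/(sub_countable (card_leT _)).
  - exact/(sub_countable (card_image_le _ _))/(sub_countable (card_leT _)).
  - exact: countable0.
have odU A : U A -> open A /\ dense A.
  case=> -[s s1 <-]; split.
  - exact: moved_open.
  - exact: fX.
  - by apply: open_comp; [move=> ? _; exact: pc|exact: moved_open].
  - move=> O [x Ox] oO.
    have [|_ [[z Oz <-] mz]] := fY s s1 (p @` O) _ (couple_open_map oO).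
      by exists (p x), x.
    by exists z.
have [x [_ Ux]] := compact_hausdorff_baire hX cX cU odU X0 openT.
exists x; split=> s; apply: contraPP => s1.
  by apply: (Ux (UX s)); left; exists s.
by apply: (Ux (UY s)); right; exists s.
Qed.

End OrbitCouple.

Section Cocycle.
Variables (G H : groupType) (X Y : topologicalType).
Variables (sX : system G X) (sY : system H Y) (p : X -> Y).
Variable a : discrete_topology G * X -> discrete_topology H.
Hypotheses (cX : compact [set: X]) (ac : continuous a).
Hypothesis pa : forall s x, p (sX s x) = sY (a (s, x)) (p x).

(** Freeness of [p x] gives the cocycle identity [a (s * t, x) = a (s, t.x) * a (t, x)], and
    [a (s, -)] has finitely many values by compactness. *)
Lemma cocycle_coarse x : free_point sY (p x) ->
  coarse_map (fun s : G => a (s, x) : H).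
Proof.
move=> fx s; have [|F aF] := compact_image_discrete cX (f := fun z => a (s, z)).
  move=> z; apply: (@continuous_comp _ _ _ (pair (s : discrete_topology G)) a).
    exact: (cvg_pair (cvg_cst (s : discrete_topology G)) cvg_id).
  exact: ac.
exists F => t; suff -> : a (s * t, x) = a (s, sX t x) * a (t, x) by rewrite mulgK.
by apply: (free_point_inj fx); rewrite actM -!pa actM.
Qed.

End Cocycle.

(** * From orbit couples to quasi-isometry *)

Lemma coupling_quasi_isometric (R : realType) (G H : groupType)
    (c : continuous_orbit_couple G H) :
  countable [set: G] -> countable [set: H] -> topologically_free_couple c ->
  finitely_generated G -> finitely_generated H /\ quasi_isometric_groups R G H.
Proof.
case: c => X Y hX hY cX cY X0 sX sY p q pc qc.
move=> [a [b [g [h [[ac bc gc hc] [pa qb qp pq]]]]]] cG cH [/= fX fY] fgG.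
have [x [fx fpx]] :=
  couple_free_point pc qc gc hc qp pq cG cH hX hY cX X0 fX fY.
have fqpx : free_point sX (q (p x)) by rewrite qp; exact: free_point_act.
pose f (s : G) : H := a (s, x).
(* The factor [g x] moves the base point from [q (p x)] back to [x], so that
   [q (t.(p x)) = (e t).x]. *)
pose e (t : H) : G := b (t, p x) * g x.
have qe t : q (sY t (p x)) = sX (e t) x by rewrite qb qp -actM.
have cf : coarse_map f by exact: cocycle_coarse cX ac pa x fpx.
have ce : coarse_map e.
  move=> t; have [F bF] := cocycle_coarse cY bc qb fqpx t.
  by exists F => u; rewrite /e mulgKA.
have fe1 : close_to_id (f \o e).
  have [F hF] := compact_image_discrete cY hc; exists F => t.
  (* Both sides send [p x] to [p (q (t.(p x)))]. *)
  suff -> : (f \o e) t = h (sY t (p x)) * t by rewrite mulgK.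
  by apply: (free_point_inj fpx); rewrite actM -pq qe pa.
have ef1 : close_to_id (e \o f).
  have [F gF] := compact_image_discrete cX gc; exists F => s.
  suff -> : (e \o f) s = g (sX s x) * s by rewrite mulgK.
  by apply: (free_point_inj fx); rewrite actM -qp -qe pa.
split; first exact: coarse_map_finitely_generated cf fe1 fgG.
by move=> S T genS genT; exists (fun s => (f s^-1)^-1);
  exact: coarse_map_quasi_isometry cf fe1 ce ef1 R S T genS genT.
Qed.

(** A homeomorphism and its inverse compose to identities, so [g] and [h] can be constantly [1]. *)
Lemma orbit_equivalence_couple (G H : groupType) (X Y : topologicalType)
    (sX : system G X) (sY : system H Y) :
  hausdorff_space X -> hausdorff_space Y ->
  compact [set: X] -> compact [set: Y] -> [set: X] !=set0 ->
  topologically_free sX -> topologically_free sY ->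
  continuously_orbit_equivalent sX sY ->
  exists c : continuous_orbit_couple G H, topologically_free_couple c.
Proof.
move=> hX hY cX cY X0 fX fY.
move=> [p [q [[pc qc pK qK] [a [b [ac bc pa qb]]]]]].
have cocycles : exists (a : discrete_topology G * X -> discrete_topology H)
    (b : discrete_topology H * Y -> discrete_topology G)
    (g : X -> discrete_topology G) (h : Y -> discrete_topology H),
    [/\ continuous a, continuous b, continuous g & continuous h] /\
    [/\ forall s x, p (sX s x) = sY (a (s, x)) (p x),
        forall t y, q (sY t y) = sX (b (t, y)) (q y),
        forall x, q (p x) = sX (g x) x & forall y, p (q y) = sY (h y) y].
  exists a, b, (cst 1), (cst 1); split; split=> //; try exact: cst_continuous.
  - by move=> x; rewrite pK act1.
  - by move=> y; rewrite qK act1.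
by exists (ContinuousOrbitCouple hX hY cX cY X0 pc qc cocycles).
Qed.

Theorem corollary6p4 (R : realType) (G H : groupType)
    (countG : countable [set: G]) (countH : countable [set: H]) :
  ((exists c : continuous_orbit_couple G H, topologically_free_couple c) ->
    finitely_generated G ->
    finitely_generated H /\ quasi_isometric_groups R G H)
  /\
  (forall (X Y : topologicalType) (sX : system G X) (sY : system H Y),
    hausdorff_space X -> hausdorff_space Y ->
    compact [set: X] -> compact [set: Y] -> [set: X] !=set0 ->
    topologically_free sX -> topologically_free sY ->
    continuously_orbit_equivalent sX sY ->
    finitely_generated G ->
    finitely_generated H /\ quasi_isometric_groups R G H).

Proof.
split=> [[c cfree]|X Y sX sY hX hY cX cY X0 fX fY coe].
  exact: coupling_quasi_isometric cfree.
have [c cfree] := orbit_equivalence_couple hX hY cX cY X0 fX fY coe.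
exact: coupling_quasi_isometric cfree.
Qed.
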